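(* The graph of curvatures of any tight trihex is a complete graph on 4 vertices.
   Context: A trihex is a finite, connected, 3-regular planar graph, drawn in the plane (regarded as part of the sphere), whose faces (including the unbounded one) all have three or six sides. Faces with three (six) sides are called triangles (hexagons). Every trihex has exactly four triangular faces (by Euler's formula). A belt is a circuit of distinct hexagonal faces in a trihex such that each hexagon is adjacent to its neighbors in the circuit on opposite edges. A trihex is tight if it does not contain any belts. A pseudo-road connecting triangular faces $c$ and $d$ is a sequence of hexagonal faces $a_1,\dots,a_\ell$ ($\ell\ge 0$) such that, setting $a_0=c$ and $a_{\ell+1}=d$, for $1\le i\le \ell$ the face $a_i$ is adjacent to $a_{i-1}$ and $a_{i+1}$ on opposite edges; that is, there are edges $e_0,\dots,e_\ell$ such that $e_i$ is shared by $a_i$ and $a_{i+1}$ for $0\le i\le \ell$, and $e_{i-1}$ and $e_i$ are opposite edges of the hexagon $a_i$ for $1\le i\le\ell$. (When $\ell=0$ this means that $c$ and $d$ share an edge.) The graph of curvatures of a trihex is the graph whose vertices are the four triangular faces, two vertices $c$ and $d$ being connected by an edge if there exists a pseudo-road connecting the faces $c$ and $d$. *)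

(* Defs.v *)
From mathcomp Require Import all_boot all_fingroup.

Set Implicit Arguments.
Unset Strict Implicit.
Unset Printing Implicit Defensive.

(* A finite graph drawn on an oriented closed surface is given by its rotation
   system. A dart is an edge together with a choice of one of its ends, where
   it is based: [flip] sends a dart to the other dart of the same edge, and
   [turn] to the next dart around its base vertex. Loops and multiple edges
   are allowed here; [trihex] below leaves no room for them. *)
Record cmap := CMap {
  dart :> finType;
  turn : {perm dart};
  flip : {perm dart};
  flipK : involutive flip;
  flip_neq : forall x, flip x != x
}.

Section Maps.
Variable G : cmap.
Implicit Types (x : G) (a b c d e : {set G}).

(* Walk along x, then take the next dart at the far end: the orbit of x is the
   boundary walk of the face on one fixed side of x, so x and flip x determine
   the faces on the two sides of an edge. *)
Definition next_side : {perm G} := (flip G * turn G)%g.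

Definition vertices : {set {set G}} := porbits (turn G).
Definition edges : {set {set G}} := porbits (flip G).
Definition faces : {set {set G}} := porbits next_side.

Definition connected_map : Prop :=
  forall x y, connect (fun u v => (v == turn G u) || (v == flip G u)) x y.

(* For a connected rotation system, the surface is the sphere if and only if
   its Euler characteristic is 2. *)
Definition spherical : Prop := #|vertices| + #|faces| = #|edges| + 2.

Definition cubic : Prop := forall v, v \in vertices -> #|v| = 3.

Definition triangles : {set {set G}} := [set a in faces | #|a| == 3].
Definition hexagons : {set {set G}} := [set a in faces | #|a| == 6].

Definition trihex : Prop :=
  [/\ connected_map, spherical, cubic
    & forall a, a \in faces -> (a \in triangles) || (a \in hexagons)].

Definition edge_of x : {set G} := porbit (flip G) x.

Definition shared_edge e a b : Prop :=
  exists x, [/\ e = edge_of x, x \in a & flip G x \in b].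

Definition opposite_edges a e e' : Prop :=
  exists x, [/\ x \in a, e = edge_of x & e' = edge_of ((next_side ^+ 3)%g x)].

(* A circuit of length 2 (two hexagons sharing two edges) is a belt, but the
   empty sequence is not. *)
Definition belt (a : seq {set G}) : Prop :=
  [/\ a != [::], uniq a, {subset a <= hexagons}
    & exists es : seq {set G}, size es = size a /\
      let A i := nth set0 a (i %% size a) in
      let E i := nth set0 es (i %% size a) in
      forall i, i < size a ->
        shared_edge (E i) (A i) (A i.+1) /\
        opposite_edges (A i.+1) (E i) (E i.+1)].

Definition tight : Prop := forall a : seq {set G}, ~ belt a.

(* With A := c, a_1, ..., a_l, d and E := e_0, ..., e_l. *)
Definition pseudo_road c d (a : seq {set G}) : Prop :=
  [/\ c \in triangles, d \in triangles, {subset a <= hexagons}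
    & exists es : seq {set G}, size es = (size a).+1 /\
      let A i := nth set0 (c :: rcons a d) i in
      let E i := nth set0 es i in
      (forall i, 0 <= i <= size a -> shared_edge (E i) (A i) (A i.+1)) /\
      (forall i, 1 <= i <= size a -> opposite_edges (A i) (E i.-1) (E i))].

Definition curvature_adj c d : Prop :=
  exists a : seq {set G}, pseudo_road c d a.

End Maps.

Definition complete_graph (T : finType) (V : {set T}) (adj : T -> T -> Prop)
    (n : nat) : Prop :=
  #|V| = n /\ forall u v, u \in V -> v \in V -> (adj u v <-> u <> v).

(* Main.v *)
Require Import Defs.
From mathcomp Require Import all_boot all_fingroup.
From mathcomp Require Import zify.

(* Let f reverse darts and p rotate them around faces. Since all faces have 3 or 6
   sides and all vertices degree 3, f ^ 2 = p ^ 6 = (f p) ^ 3 = 1, so f and p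
   generate a quotient of the rotation group of the hexagonal tiling, acting
   transitively on the darts. Its translations form an abelian group T, and
   p ^ 3 inverts T. Rotations of order 3 or 6, and half-turns about midpoints of
   edges, fix no dart; the darts of triangles are those fixed by p ^ 3.
   Pseudo-roads are segments of lines, i.e. of orbits of a translation a by one
   face; a line that meets no triangle is a belt. So in a tight trihex each of
   the three directions generates T modulo the translations taking triangles to
   triangles, and the pseudo-roads leaving a triangle in the directions a, b, ab
   have the same length n. None of a ^ n, b ^ n, (ab) ^ n leads back to the
   initial triangle, for otherwise a half-turn about the midpoint of the road
   would fix a dart, and this midpoint would be an edge midpoint or lie in an
   earlier triangle. Hence they lead to three distinct other triangles, and
   Euler's formula gives exactly four triangles. *)

Set Implicit Arguments.
Unset Strict Implicit.
Unset Printing Implicit Defensive.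

(** * Translations in the rotation group of the hexagonal tiling *)

Section HexagonalGroup.
Local Open Scope group_scope.
Variables (gT : finGroupType) (f p : gT).
Hypotheses (ff : f * f = 1) (p6 : p ^+ 6 = 1) (fp3 : (f * p) ^+ 3 = 1).

(* When f and p are the flip and the face rotation, [step] crosses an edge and
   then goes to the opposite side of the face entered. In a triangle [p ^+ 3] is
   trivial, so there [step] turns back. *)
Definition step := f * p ^+ 3.
Definition step2 := step ^ p ^- 2.
Definition translations := <<[set step; step2]>>.
Local Notation a := step.
Local Notation b := step2.
Local Notation T := translations.

Lemma fV : f^-1 = f.
Proof. by apply/eqP; rewrite eq_invg_mul ff. Qed.

Lemma p3V : p ^- 3 = p ^+ 3.
Proof. by apply/eqP; rewrite eq_invg_mul -expgD p6. Qed.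

Lemma p3K : p ^+ 3 * p ^+ 3 = 1.
Proof. by rewrite -expgD p6. Qed.

Lemma stepJ3 : a ^ (p ^+ 3) = a^-1.
Proof.
rewrite /step conjgE p3V; have := p3V; move: (p ^+ 3) p3K => r rK rV.
by rewrite invMg rV fV -!mulgA rK mulg1.
Qed.

Lemma step2J1 : b ^ p^-1 = a^-1.
Proof. by rewrite -stepJ3 /step2 -conjgM -invMg -expgS p3V. Qed.

(** The vertex relation enters as [p * f * p = f * p^-1 * f]. *)
Lemma stepJ1 : a ^ p^-1 = a * b.
Proof.
have pfp : p * f * p = f * p^-1 * f.
  move: fp3; rewrite !expgS expg0 mulg1 => /eqP.
  rewrite -eq_invg_mul invMg fV => /eqP E.
  by rewrite -(mulgA f) E !mulgA ff mul1g.
have p5 : p ^+ 3 * (p * p) = p^-1.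
  by apply/eqP; rewrite eq_sym eq_invg_mul -p6 !expgS expg0 !mulg1 !mulgA.
have p3E : p ^+ 3 = p * p * p by rewrite !expgS expg0 !mulg1 !mulgA.
rewrite /step2 /step /conjg !invgK expg2 invMg.
transitivity (p * f * p * p); first by rewrite p3E !mulgA mulgK.
transitivity (f * (p ^+ 3 * (p * p)) * f * p); first by rewrite p5 pfp.
by rewrite p3E !mulgA 2!mulgK.
Qed.

(** Conjugating [a] twice by [p^-1] gives [b] by definition, and [a * b * a^-1] by [stepJ1] and
    [step2J1]. *)
Lemma commute_steps : commute a b.
Proof.
have E : b = a * b * a^-1.
  have : (a ^ p^-1) ^ p^-1 = a * b * a^-1.
    by rewrite stepJ1 conjMg stepJ1 step2J1.
  by rewrite -conjgM -invMg -expg2.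
by rewrite /commute {2}E mulgKV.
Qed.

Lemma conj_translations i t : t \in T -> t ^ (p ^- i) \in T.
Proof.
have Ta : a \in T by rewrite mem_gen ?set21.
have Tb : b \in T by rewrite mem_gen ?set22.
have sT : T :^ p^-1 \subset T.
  rewrite -genJ gen_subG; apply/subsetP=> _ /imsetP[x /set2P[]-> ->].
    by rewrite stepJ1 groupM.
  by rewrite step2J1 groupV.
move=> Tt; elim: i => [|i IH]; first by rewrite expg0 invg1 conjg1.
by rewrite expgS invMg conjgM (subsetP sT) // memJ_conjg.
Qed.

Lemma translationsC t u : t \in T -> u \in T -> commute t u.
Proof.
have abT : abelian T.
  rewrite abelian_gen; apply/centsP=> _ /set2P[]-> _ /set2P[]-> //.
    exact: commute_steps.
  exact/commute_sym/commute_steps.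
by move=> Tt Tu; apply: (centsP abT).
Qed.

Lemma translationsP t :
  reflect (exists i j, t = a ^+ i * b ^+ j) (t \in T).
Proof.
apply: (iffP idP) => [|[i [j ->]]]; last first.
  by rewrite groupM ?groupX ?mem_gen ?set21 ?set22.
have abC := cents_cycle commute_steps.
have -> : T = <[a]> * <[b]> by rewrite -cent_joinEl // joing_idl joing_idr.
by case/mulsgP=> _ _ /cycleP[i ->] /cycleP[j ->] ->; exists i, j.
Qed.

End HexagonalGroup.

(** * Orbit partitions and permutations without fixed points *)

Lemma partition_porbits (S : finType) (s : {perm S}) : partition (porbits s) [set: S].
Proof.
apply/and3P; split.
- rewrite eqEsubset subsetT; apply/subsetP=> x _; apply/bigcupP.
  by exists (porbit s x); [apply: imset_f | apply: porbit_id].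
- apply/trivIsetP=> _ _ /imsetP[x _ ->] /imsetP[y _ ->]; apply: contraR.
  case/pred0Pn=> z /andP[/= zx zy]; move: zx zy; rewrite -!eq_porbit_mem.
  by move=> /eqP <-.
- by apply/imsetP=> -[x _ E]; have := porbit_id s x; rewrite -E inE.
Qed.

Section FixFree.
Local Open Scope group_scope.
Variable T : finType.
Implicit Types s t : {perm T}.

Definition fixfree s := forall x, s x != x.

Lemma fixfreeJ s t : fixfree s -> fixfree (s ^ t).
Proof.
move=> ffs x; rewrite /conjg !permM; apply: contra_neq (ffs (t^-1 x)) => E.
by rewrite -{2}E permK.
Qed.

Lemma fixfreeV s : fixfree s -> fixfree s^-1.
Proof. by move=> ffs x; apply: contra_neq (ffs x) => E; rewrite -{1}E permKV. Qed.

Lemma fixfreeX s n : fixfree (s ^+ n) -> fixfree s.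
Proof. by move=> ffs x; apply: contra_neq (ffs x) => E; rewrite permX iter_fix. Qed.

End FixFree.

(** * The group acting on the darts of a trihex, and its fixed darts *)

Section Trihex.
Local Open Scope group_scope.
Variable G : cmap.
Hypothesis trihexG : trihex G.
Implicit Types (x y z : G) (t u : {perm G}).

Local Notation f := (flip G).
Local Notation p := (next_side G).
Local Notation a := (step f p).
Local Notation b := (step2 f p).
Local Notation T := (translations f p).

Definition in_triangle x := (p ^+ 3) x == x.

Lemma mem_faces x : porbit p x \in faces G.
Proof. exact: imset_f. Qed.

Lemma card_face x : #|porbit p x| = if in_triangle x then 3 else 6.
Proof.
have [_ _ _ /(_ _ (mem_faces x))] := trihexG.
rewrite !inE mem_faces /= /in_triangle permX; case/orP=> /eqP h.
  by have := iter_porbit p x; rewrite h => ->; rewrite eqxx.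
have := uniq_traject_porbit p x; rewrite h /= !inE !negb_or.
by case/andP=> /and5P[_ _ n3 _ _] _; rewrite eq_sym (negPf n3).
Qed.

Lemma triangle_porbit x : (porbit p x \in triangles G) = in_triangle x.
Proof. by rewrite inE mem_faces card_face; case: in_triangle. Qed.

Lemma hexagon_porbit x : (porbit p x \in hexagons G) = ~~ in_triangle x.
Proof. by rewrite inE mem_faces card_face; case: in_triangle. Qed.

Lemma flipM : f * f = 1.
Proof. by apply/permP=> x; rewrite permM perm1 flipK. Qed.

Lemma next_side6 : p ^+ 6 = 1.
Proof.
apply/permP=> x; rewrite perm1.
have := iter_porbit p x; rewrite card_face -permX; case: in_triangle => // E.
by rewrite (expgD p 3 3) permM !E.
Qed.

Lemma turnE : turn G = f * p.
Proof. by rewrite /next_side mulgA flipM mul1g. Qed.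

Lemma card_vertex x : #|porbit (turn G) x| = 3.
Proof. by have [_ _ -> //] := trihexG; apply: imset_f. Qed.

Lemma flip_next3 : (f * p) ^+ 3 = 1.
Proof.
by apply/permP=> x; rewrite -turnE permX perm1 -{1}(card_vertex x) iter_porbit.
Qed.

Lemma fixfree_turn : fixfree (turn G).
Proof.
move=> x; have := uniq_traject_porbit (turn G) x.
by rewrite card_vertex /= !inE negb_or => /andP[/andP[n1 _] _]; rewrite eq_sym.
Qed.

Lemma fixfree_next2 : fixfree (p ^+ 2).
Proof.
move=> x; have := uniq_traject_porbit p x; rewrite card_face permX eq_sym.
by case: ifP => _; rewrite /= !inE !negb_or -!andbA => /and3P[].
Qed.

Let memTJ := conj_translations flipM next_side6 flip_next3.
Let TC := translationsC flipM next_side6 flip_next3.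
Let TP := translationsP flipM next_side6 flip_next3.

Lemma mem_step : a \in T. Proof. by rewrite mem_gen ?set21. Qed.
Lemma mem_step2 : b \in T. Proof. by rewrite mem_gen ?set22. Qed.
Hint Resolve mem_step mem_step2 : core.

Lemma conj_next2 t u : t \in T -> u \in T ->
  (p ^+ 2 * t) ^ u = p ^+ 2 * ((u^-1) ^ (p ^+ 2) * u * t).
Proof.
move=> Tt Tu; rewrite /conjg -(mulgA (p ^+ 2)) (TC Tt Tu) !mulgA.
by rewrite mulgV mul1g.
Qed.

Lemma step_next2 : a ^ (p ^+ 2) = (a * b)^-1.
Proof.
rewrite -(stepJ1 flipM next_side6 flip_next3) -conjVg.
by rewrite -(stepJ3 flipM next_side6) -conjgM (expgSr p 2) mulgK.
Qed.

Lemma step2_next2 : b ^ (p ^+ 2) = a.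
Proof. by rewrite /step2 -conjgM mulVg conjg1. Qed.

Lemma next2_stepV : p ^+ 2 * a^-1 = (turn G)^-1.
Proof.
rewrite turnE /step (invMg f (p ^+ 3)) (invMg f p) (fV flipM).
rewrite (p3V next_side6) mulgA -expgD.
congr (_ * _); apply/eqP; rewrite eq_sym eq_invg_mul -expgS.
by rewrite next_side6.
Qed.

Lemma next2_step : (p ^+ 2 * a) ^ (p ^- 3) = (turn G)^-1.
Proof.
have assoc r s w : w * (r * (s * w) * w^-1) = w * r * s :> {perm G}.
  by rewrite !mulgA mulgK.
rewrite turnE /step /conjg (invMg f p) (fV flipM) invgK assoc -expgD.
congr (_ * _); apply/eqP; rewrite eq_sym eq_invg_mul -expgS.
by rewrite next_side6.
Qed.

(* A translate of a rotation of order 3 is a rotation about the centre of a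
   face or about a vertex. *)
Lemma fixfree_next2M t : t \in T -> fixfree (p ^+ 2 * t).
Proof.
(* Conjugation by [a * b^-1] multiplies the translation part by [a ^+ 3]. *)
have shift u : u \in T -> fixfree (p ^+ 2 * u) -> fixfree (p ^+ 2 * (a ^+ 3 * u)).
  have Tab : a * b^-1 \in T by apply: groupM => //; rewrite groupV.
  move=> Tu /(@fixfreeJ _ _ (a * b^-1)).
  rewrite conj_next2 // (invMg a) invgK conjMg conjVg.
  rewrite step_next2 step2_next2 !invgK.
  have cancel r s w : commute r s ->
      r * (r * s) * (r * s^-1) * w = r ^+ 3 * w :> {perm G}.
    by move=> rs; rewrite !expgS expg0 mulg1 -!mulgA (mulgA s) -rs -mulgA mulKVg.
  by rewrite cancel //; apply: TC.
(* Modulo 3, the exponent is 0 (a face centre), 1 or -1 (vertices). *)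
have stepX k : fixfree (p ^+ 2 * a ^+ k).
  have [n] := ubnP k; elim: n k => // n IH [|[|[|k]]] kn.
  - by rewrite mulg1; apply: fixfree_next2.
  - rewrite -(conjgK (p ^- 3) (_ * _)) next2_step.
    exact/fixfreeJ/fixfreeV/fixfree_turn.
  - rewrite -(mulgK a (a ^+ 2)) -expgSr; apply: shift; first by rewrite groupV.
    by rewrite next2_stepV; apply/fixfreeV/fixfree_turn.
  rewrite -add3n expgD; apply: shift; first by rewrite groupX.
  by apply: IH; rewrite ltnW // ltnW.
case/TP=> i [j ->].
(* Conjugation by [b ^+ j] trades a factor [a ^+ j] for [b ^+ j]. *)
move/(@fixfreeJ _ _ (b ^+ j)): (stepX (i + j)).
have cancel r s w : commute r s -> commute s w ->
    r^-1 * s * (r * w) = w * s :> {perm G}.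
  by move=> rs sw; rewrite mulgA -(mulgA _ s) -rs mulKg sw.
have [Ta Tb] : a ^+ j \in T /\ b ^+ j \in T by split; apply: groupX.
rewrite conj_next2 // ?groupX // conjVg conjXg step2_next2 addnC expgD.
by rewrite cancel //; apply: TC => //; apply: groupX.
Qed.

(** A fixed dart is also fixed by all powers, and at most two squarings bring the exponent of [p] to
    2 modulo 6. *)
Lemma fixfree_rotation t i : t \in T -> ~~ (3 %| i) -> fixfree (t * p ^+ i).
Proof.
have sq s j : s \in T ->
    exists2 s', s' \in T & (s * p ^+ j) ^+ 2 = s' * p ^+ (j * 2).
  move=> Ts; exists (s * s ^ (p ^- j)); first by rewrite groupM ?memTJ.
  by rewrite muln2 -addnn expgD expg2 /conjg invgK !mulgA mulgKV.
have ff2 s j : s \in T -> j %% 6 = 2 -> fixfree (s * p ^+ j).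
  move=> Ts j2; rewrite -(expg_mod _ next_side6) j2.
  have -> : s * p ^+ 2 = (p ^+ 2 * s) ^ s^-1 by rewrite /conjg invgK mulgK.
  exact/fixfreeJ/fixfree_next2M.
have ff4 s j : s \in T -> j * 2 %% 6 = 2 -> fixfree (s * p ^+ j).
  move=> Ts j2; apply: (@fixfreeX _ _ 2).
  by have [s' Ts' ->] := sq s j Ts; apply: ff2.
move=> Tt i3; have [i2|i2] := eqVneq (i * 2 %% 6) 2; first exact: ff4.
have [i2'|i2'] := eqVneq (i %% 6) 2; first exact: ff2.
apply: (@fixfreeX _ _ 2); have [s Ts ->] := sq t i Tt; apply: ff4 => //.
move: i2 i2' i3; rewrite -mulnA -!(modnMml i) /dvdn -(@modn_dvdm 6 i 3) //.
by case: (i %% 6) (@ltn_pmod i 6 isT); do 6?case=> //.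
Qed.

(** If [t x = (p ^+ i) x], then [p ^+ i * t^-1] fixes [x], so [fixfree_rotation] forces 3 to divide
    [i]. *)
Lemma same_face x t : t \in T -> t x \in porbit p x -> t x = x \/ t x = (p ^+ 3) x.
Proof.
move=> Tt /porbitP[i E]; rewrite E -(expg_mod _ next_side6).
have : 3 %| i.
  apply: contraT => i3; have /eqP[] := fixfree_rotation (memTJ i (groupVr Tt)) i3 x.
  by rewrite /conjg invgK !mulgA mulgKV permM -E permK.
rewrite /dvdn -(@modn_dvdm 6 i 3) //; case: (i %% 6) (@ltn_pmod i 6 isT).
  by left; rewrite perm1.
by do 5?[case=> //]; right.
Qed.

Lemma connected_orbit x y : exists2 t, t \in T & exists i, y = (t * p ^+ i) x.
Proof.
have [/(_ x y) conn _ _ _] := trihexG; case/connectP: conn => s.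
elim/last_ind: s y => [|s z IH] y.
  move=> _ ->; exists 1; first by rewrite group1.
  by exists 0; rewrite mulg1 perm1.
rewrite rcons_path last_rcons => /andP[/IH/(_ erefl)[t Tt [i ->]] fz ->].
have fE : f = a * p ^+ 3 by rewrite /step -mulgA -expgD next_side6 mulg1.
have Ef : (t * p ^+ i) * f = (t * a ^ (p ^- i)) * p ^+ (i + 3).
  by rewrite {1}fE expgD /conjg invgK !mulgA mulgKV.
have Tt' : t * a ^ (p ^- i) \in T by apply: groupM => //; apply: memTJ.
exists (t * a ^ (p ^- i)) => //; case/orP: fz => /eqP->.
  exists (i + 3).+1; rewrite turnE (expgSr p (i + 3)).
  by rewrite (mulgA _ (p ^+ (i + 3))) -Ef !permM.
by exists (i + 3); rewrite -Ef !permM.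
Qed.

Lemma conj_next3 t : t \in T -> t ^ (p ^+ 3) = t^-1.
Proof.
have aJ := stepJ3 flipM next_side6.
have bJ : b ^ (p ^+ 3) = b^-1.
  rewrite /step2 -conjVg -aJ -!conjgM; congr (_ ^ _).
  exact/commute_sym/commuteV/commuteX2.
move=> Tt; case/TP: (Tt) => i [j tE].
rewrite tE conjMg !conjXg aJ bJ !expVgn -invMg; congr (_^-1).
by apply: TC; apply: groupX.
Qed.

Lemma next3K t : t \in T -> t * p ^+ 3 = p ^+ 3 * t^-1.
Proof. by move=> Tt; rewrite conjgC conj_next3. Qed.

(** As [p ^+ 3] fixes [x] and inverts [T], it sends [t x] to [t^-1 x]. *)
Lemma in_triangle_translation t x : t \in T -> in_triangle x ->
  in_triangle (t x) = ((t ^+ 2) x == x).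
Proof.
move=> Tt /eqP tx; rewrite /in_triangle -permM next3K // permM tx.
by rewrite -(inj_eq (@perm_inj _ t)) permKV -permM -expg2 eq_sym.
Qed.

Lemma in_triangle_next i x : in_triangle ((p ^+ i) x) = in_triangle x.
Proof.
by rewrite -!triangle_porbit porbit_perm.
Qed.

(** The half-turn [a ^+ k * p ^+ 3] fixes [x]. For odd [k] it is conjugate to [f], which fixes no
    dart; for [k = i.*2] it is conjugate to [p ^+ 3], and its centre is that of the face of
    [(a ^+ i) x]. *)
Lemma step_fold x k : (a ^+ k) x = (p ^+ 3) x ->
  exists2 i, k = i.*2 & in_triangle ((a ^+ i) x).
Proof.
move=> E.
have Tai i : a ^+ i \in T by apply: groupX.
have p3p3 := p3K next_side6.
have fixx : (a ^+ k * p ^+ 3) x = x.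
  by rewrite permM E -permM p3p3 perm1.
move: fixx; rewrite -(odd_double_half k); set i := k./2.
case: (odd k); rewrite ?add0n ?add1n -addnn => fixx; last first.
  exists i; first by rewrite addnn.
  apply/eqP; rewrite -permM -[LHS](permKV (a ^+ i)); congr (_ _).
  by rewrite -[RHS]fixx -permM expgD -[in RHS]mulgA [in RHS](next3K (Tai i)) !mulgA.
have /eqP[] := @fixfreeJ _ f (a ^- i) (flip_neq (c:=G)) x.
rewrite -[RHS]fixx -addSn expgD expgSr -(mulgA (a ^+ i * a)) next3K //.
have fE : f = a * p ^+ 3 by rewrite /step -mulgA p3p3 mulg1.
by rewrite {1}fE /conjg invgK !mulgA.
Qed.

Lemma step_edge x : edge_of (f x) = edge_of x.
Proof. by rewrite /edge_of -{2}[f]expg1 porbit_perm. Qed.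

Lemma step_face x : porbit p (a x) = porbit p (f x).
Proof. by rewrite /step permM porbit_perm. Qed.

Lemma edge_of_mem x y : edge_of x = edge_of y -> x = y \/ x = f y.
Proof.
move=> E; have : x \in edge_of y by rewrite -E; apply: porbit_id.
case/porbitP=> i ->; rewrite -(odd_double_half i) expgD -muln2 mulnC expgM.
rewrite expg2 flipM expg1n mulg1; case: (odd i); rewrite ?expg1; auto.
by left; rewrite perm1.
Qed.

Lemma next_conj t i : p ^+ i * t = t ^ (p ^- i) * p ^+ i.
Proof. by rewrite /conjg invgK !mulgA mulgKV. Qed.

(** With [t] triangles and [h] hexagons, counting darts gives 3V = 2E = 3t + 6h; with V + t + h = E
    + 2 this forces t = 4. *)
Lemma card_triangles : #|triangles G| = 4.
Proof.
have [_ sph cub _] := trihexG.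
have V3 := card_uniform_partition cub (partition_porbits (turn G)).
have E2 : #|[set: G]| = (#|edges G| * 2)%N.
  apply: card_uniform_partition (partition_porbits f) => _ /imsetP[x _ ->].
  have -> : porbit f x = [set x; f x].
    apply/setP=> y; rewrite !inE -eq_porbit_mem; apply/eqP/orP=> [/edge_of_mem|].
      by case=> ->; rewrite eqxx; auto.
    by case=> /eqP-> //; apply: step_edge.
  by rewrite cards2 eq_sym flip_neq.
have face6 A : A \in faces G -> (#|A| != 3) = (#|A| == 6).
  by case/imsetP=> x _ ->; rewrite card_face; case: in_triangle.
have F36 : #|[set: G]| = (#|triangles G| * 3 + #|hexagons G| * 6)%N.
  rewrite (card_partition (partition_porbits p)).
  rewrite (bigID (fun A : {set G} => #|A| == 3)) -!sum_nat_const /=.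
  congr (_ + _); apply: eq_big => A; rewrite ?inE //; try by case/andP=> _ /eqP.
    by apply: andb_id2l => /face6.
  by case/andP=> /face6 -> /eqP.
have F : #|faces G| = #|triangles G| + #|hexagons G|.
  rewrite -!sum1_card (bigID (fun A : {set G} => #|A| == 3)) /=.
  congr (_ + _); apply: eq_bigl => A; rewrite inE //.
  by apply: andb_id2l => /face6.
move: sph; rewrite /spherical; lia.
Qed.

(** * Pseudo-roads as segments of orbits of [step] *)

Definition road x n := [/\ in_triangle x, in_triangle ((a ^+ n.+1) x)
  & forall i, 0 < i <= n -> ~~ in_triangle ((a ^+ i) x)].

Lemma road_from x : in_triangle x -> exists n, road x n.
Proof.
move=> tx; have ex : exists n, in_triangle ((a ^+ n.+1) x).
  by exists #[a].-1; rewrite prednK ?order_gt0 // expg_order perm1.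
have [n tn min] := ex_minnP ex; exists n; split=> // -[//|i] /andP[_ lt_in].
by apply/negP=> /min; rewrite leqNgt lt_in.
Qed.

(** An end in the initial face would be [x] itself, since [p ^+ 3] fixes [x]; then [step_fold] puts
    a triangle halfway along the road. *)
Lemma road_end x n : road x n -> (a ^+ n.+1) x \notin porbit p x.
Proof.
case=> /eqP tx tn hex; apply/negP=> /(same_face (groupX n.+1 mem_step)) E.
have {E} /step_fold[i ni ti] : (a ^+ n.+1) x = (p ^+ 3) x.
  by case: E => ->; rewrite ?tx.
case: i ni ti => // i ni ti; have := hex i.+1; rewrite ti => /(_ _)/negP[] //.
by move: ni; lia.
Qed.

Lemma stepS i x : (a ^+ i.+1) x = (p ^+ 3) (f ((a ^+ i) x)).
Proof. by rewrite (expgSr a i) permM [a _]permM. Qed.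

(** By transitivity and commutativity, a fixed dart of [a] yields one in a triangle, where
    [step_fold] excludes the odd exponent 1. *)
Lemma step_neq x : a x != x.
Proof.
have [c] : exists c, c \in triangles G by apply/card_gt0P; rewrite card_triangles.
move=> tc; have : c \in faces G by move: tc; rewrite inE => /andP[].
case/imsetP=> z _ cE; move: tc; rewrite cE triangle_porbit => tz.
have [t Tt [i ->]] := connected_orbit z x; apply/eqP=> E.
have tz' : in_triangle ((p ^+ i) z) by rewrite in_triangle_next.
have : (a ^+ 1) ((p ^+ i) z) = (p ^+ 3) ((p ^+ i) z).
  rewrite (eqP tz') expg1 -permM next_conj permM.
  congr (_ _); apply: (@perm_inj _ (t * p ^+ i)); rewrite -permM -[RHS]E -permM.
  by rewrite -[in RHS]mulgA next_conj [in RHS]mulgA (TC Tt (memTJ i mem_step)) mulgA.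
by case/step_fold; case.
Qed.

Lemma flip_notin_face x : f x \notin porbit p x.
Proof.
rewrite -eq_porbit_mem -step_face eq_porbit_mem; apply/negP.
case/same_face=> // [/eqP|]; first by apply/negP/step_neq.
by rewrite /step permM => /perm_inj/eqP; apply/negP; apply: flip_neq.
Qed.

(** The edges determine darts only up to [flip]. Since no face borders itself, membership in the
    faces selects the right dart, so the edges are those of the [(a ^+ i) x]. *)
Lemma pseudo_road_step c d s : pseudo_road c d s ->
  exists x, [/\ c = porbit p x, d = porbit p ((a ^+ (size s).+1) x)
    & road x (size s)].
Proof.
case=> tc td hexs [es [sz_es [se oe]]].
set A := fun i => nth set0 (c :: rcons s d) i.
set E := fun i => nth set0 es i.
have facesP e z : e \in triangles G \/ e \in hexagons G -> z \in e -> e = porbit p z.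
  rewrite !inE => ez ze.
  have : e \in faces G by case: ez => /andP[].
  by case/imsetP=> w _ wE; apply/eqP; move: ze; rewrite wE eq_sym eq_porbit_mem.
have AT i : 0 < i <= size s -> A i \in hexagons G.
  case: i => // i /= lt_is; rewrite /A /= nth_rcons lt_is.
  exact/hexs/mem_nth.
have Ad : A (size s).+1 = d by rewrite /A /= nth_rcons ltnn eqxx.
have Aface i z : i <= (size s).+1 -> z \in A i -> A i = porbit p z.
  move=> le_is; apply: facesP; case: i le_is => [|i]; first by left.
  rewrite leq_eqVlt => /orP[/eqP->|lt_is]; first by left; rewrite Ad.
  by right; apply: AT.
have [x [E0 xc fx1]] : shared_edge (E 0) (A 0) (A 1%N) by apply: se.
have inv i : i <= size s ->
    [/\ A i = porbit p ((a ^+ i) x), E i = edge_of ((a ^+ i) x)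
      & A i.+1 = porbit p ((a ^+ i.+1) x)].
  elim: i => [_|i IH lt_is].
    rewrite expg0 expg1 perm1 step_face; split=> //; last exact: Aface.
    exact: Aface.
  have [Ai Ei Ai1] := IH (ltnW lt_is).
  have Ei1 : E i.+1 = edge_of ((a ^+ i.+1) x).
    have [y [yA]] := oe i.+1 lt_is; rewrite -/(E i) -/(E i.+1) Ei.
    case/esym/edge_of_mem=> yE ->.
      have := flip_notin_face ((a ^+ i) x); rewrite porbit_sym -step_face.
      by rewrite -permM -expgSr -Ai1 -yE yA.
    by rewrite yE stepS.
  split=> //; have [y [yE yA fyA]] := se i.+1 lt_is.
  move: yE; rewrite -/(E i.+1) Ei1 => /esym/edge_of_mem[] yE.
    by rewrite expgSr permM step_face -yE; apply: Aface.
  have := flip_notin_face ((a ^+ i.+1) x).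
  by rewrite -yE -Ai1 yA.
exists x; have [_ _ dE] := inv _ (leqnn (size s)).
have cE : c = porbit p x by have [A0 _ _] := inv 0 isT; rewrite -[c]/(A 0) A0 perm1.
split=> //; rewrite -?dE ?Ad //; split.
- by rewrite -triangle_porbit -cE.
- by rewrite -triangle_porbit -dE Ad.
move=> i is_; rewrite -hexagon_porbit.
by have [<- _ _] := inv i (proj2 (andP is_)); apply: AT.
Qed.

Lemma road_pseudo_road x n : road x n ->
  curvature_adj (porbit p x) (porbit p ((a ^+ n.+1) x)).
Proof.
case=> tx tn hex; pose F i := porbit p ((a ^+ i) x).
exists (mkseq (F \o succn) n); split.
- by rewrite triangle_porbit.
- by rewrite triangle_porbit.
- move=> e /mapP[i]; rewrite mem_iota add0n /= => lt_in ->.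
  by rewrite hexagon_porbit hex.
exists (mkseq (fun i => edge_of ((a ^+ i) x)) n.+1);
rewrite !size_mkseq; split=> // A E.
have AE i : i <= n.+1 -> A i = F i.
  rewrite leq_eqVlt ltnS => /orP[/eqP->|].
    by rewrite /A /= nth_rcons size_mkseq ltnn eqxx.
  case: i => [|i] le_in; first by rewrite /A /F expg0 perm1.
  by rewrite /A /= nth_rcons size_mkseq le_in nth_mkseq.
have EE i : i <= n -> E i = edge_of ((a ^+ i) x) by move=> le_in; rewrite /E nth_mkseq.
split=> [i|[//|i]] /andP[_ le_in].
  rewrite EE // (AE i (leqW le_in)) (AE i.+1 le_in).
  exists ((a ^+ i) x); rewrite porbit_id /F expgSr permM.
  by rewrite step_face porbit_id.
rewrite AE ?leqW // !EE // 1?ltnW //.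
(* This dart of the entry edge lies in the face being entered. *)
exists (f ((a ^+ i) x)); rewrite /F expgSr permM step_face porbit_id step_edge.
by split=> //; rewrite /step permM.
Qed.

(** Stepping from [(p ^+ i) x], read as a translation of [x] (see [step_next]). For [i] = 0, 1, 2
    these are [a], [a * b], [b]. *)
Definition direction i := a ^ (p ^- i).

Lemma mem_direction i : direction i \in T. Proof. exact: memTJ. Qed.
Hint Resolve mem_direction : core.

Lemma step_next i m x :
  (a ^+ m) ((p ^+ i) x) = (p ^+ i) ((direction i ^+ m) x).
Proof. by rewrite -!permM next_conj conjXg. Qed.

Lemma in_triangle_step i m x :
  in_triangle ((a ^+ m) ((p ^+ i) x)) = in_triangle ((direction i ^+ m) x).
Proof. by rewrite step_next in_triangle_next. Qed.

(** * Tight trihexes: roads from one triangle have equal lengths and distinct ends *)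

Section Tight.
Hypothesis tightG : tight G.

Lemma tight_in_triangle x : exists k, in_triangle ((a ^+ k) x).
Proof.
have [/existsP[_ /andP[/porbitP[k ->] tk]]|] :=
  boolP [exists y in porbit a x, in_triangle y]; first by exists k.
rewrite negb_exists => /forallP no.
have hex k : ~~ in_triangle ((a ^+ k) x).
  by have := no ((a ^+ k) x); rewrite mem_porbit.
set m := #|porbit a x|.
have m0 : 0 < m by rewrite lt0n card_porbit_neq0.
have per k : (a ^+ (k %% m)) x = (a ^+ k) x.
  rewrite {2}(divn_eq k m) expgD mulnC expgM permM (permX (a ^+ m)) iter_fix //.
  by rewrite permX; apply: iter_porbit.
pose F k := porbit p ((a ^+ k) x).
case: (tightG (a := mkseq F m)); split.
- by rewrite -size_eq0 size_mkseq -lt0n.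
- apply/mkseq_uniqP => i j; rewrite !inE.
  wlog ij : i j / i <= j.
    by move=> H im jm E; case/orP: (leq_total i j) => ij; [|symmetry]; apply: H.
  (* A repeated face means either a repeated dart or a fold, which would place a triangle on the
     line. *)
  move=> im jm /esym/eqP; rewrite eq_porbit_mem -(subnK ij) addnC expgD permM.
  case/same_face; first exact: groupX.
    rewrite -permM -expgD subnKC // !permX => /eqP.
    rewrite -!(nth_traject a (n := m)) // nth_uniq ?size_traject //.
      by rewrite eq_sym => /eqP.
    exact: uniq_traject_porbit.
  case/step_fold=> h _; rewrite -permM -expgD => th.
  by have := hex (i + h); rewrite th.
- by move=> _ /mapP[k _ ->]; rewrite hexagon_porbit.
exists (mkseq (fun k => edge_of ((a ^+ k) x)) m);
rewrite !size_mkseq; split=> // A E i _.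
rewrite /A /E !nth_mkseq ?ltn_pmod // /F !per.
split.
  exists ((a ^+ i) x); rewrite porbit_id expgSr permM; split=> //.
  by rewrite step_face porbit_id.
exists (f ((a ^+ i) x)); rewrite expgSr permM step_face porbit_id step_edge.
by split=> //; rewrite /step permM.
Qed.

(* Tightness makes any line meet the translates of x lying in triangles, so
   these form a subgroup whose quotient is generated by any one direction. *)
Lemma in_triangle_direction i j m x : in_triangle x ->
  in_triangle ((direction i ^+ m) x) -> in_triangle ((direction j ^+ m) x).
Proof.
move=> tx; rewrite !in_triangle_translation ?groupX // => /eqP fixi.
(* The line in direction [i] through [direction j x] meets a triangle, so [s ^+ 2] below fixes [x].
   In its [m]-th power the factor from direction [i] fixes [x], hence so does the other. *)
have [k] := tight_in_triangle ((p ^+ i) (direction j x)).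
rewrite in_triangle_step -permM in_triangle_translation //; last first.
  by apply: groupM => //; apply: groupX.
set s := _ * _ => /eqP fixs.
have cij : commute (direction j) (direction i ^+ k) by apply: TC => //; apply: groupX.
have sm : (s ^+ 2) ^+ m = (direction j ^+ m) ^+ 2 * ((direction i ^+ m) ^+ 2) ^+ k.
  rewrite -!expgM mulnC expgMn // -!expgM; congr (_ * _ ^+ _); lia.
have fixm : ((s ^+ 2) ^+ m) x = x by rewrite permX iter_fix.
have fixk : (((direction i ^+ m) ^+ 2) ^+ k) x = x by rewrite permX iter_fix.
apply/eqP/(@perm_inj _ (((direction i ^+ m) ^+ 2) ^+ k)).
by rewrite -permM -sm fixm fixk.
Qed.

Lemma road_direction x n i : road x n -> road ((p ^+ i) x) n.
Proof.
have dir j k : in_triangle x ->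
    in_triangle ((a ^+ k) ((p ^+ j) x)) = in_triangle ((a ^+ k) x).
  move=> tx; rewrite -{2}[x]perm1 -[1](expg0 p) !in_triangle_step.
  by apply/idP/idP; apply: in_triangle_direction.
case=> tx tn hex; split; rewrite ?in_triangle_next ?dir //.
by move=> k /hex; rewrite dir.
Qed.

Lemma direction_fixfree x n i : road x n -> (direction i ^+ n.+1) x != x.
Proof.
move=> /(road_direction i)/road_end; apply: contraNneq => E.
by rewrite step_next E porbit_id.
Qed.

Lemma direction1 : direction 1 = a * b.
Proof. by rewrite /direction expg1 (stepJ1 flipM next_side6 flip_next3). Qed.

Lemma road_ends_neq x n i j : road x n -> i < j < 3 ->
  (direction i ^+ n.+1) x != (direction j ^+ n.+1) x.
Proof.
move=> rx ij; apply/eqP.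
have d0 : direction 0 = a by rewrite /direction expg0 invg1 conjg1.
have cab := TC mem_step mem_step2.
have abX : (a * b) ^+ n.+1 = b ^+ n.+1 * a ^+ n.+1.
  by rewrite expgMn //; apply: TC; apply: groupX.
have fix0 := direction_fixfree 0 rx; have fix1 := direction_fixfree 1 rx.
have fix2 := direction_fixfree 2 rx.
move: fix0 fix1 fix2; rewrite direction1 -[direction 2]/b d0 => fix0 fix1 fix2.
have [tx tax _] := rx.
case: i j ij => [|[|[|i]]] [|[|[|j]]] //=; rewrite ?ltnS ?andbF // => _;
  rewrite ?d0 ?direction1 -?[direction 2]/b.
- by rewrite abX permM => /esym/perm_inj/eqP; apply/negP.
(* If [a] and [b] lead to the same dart, then [a * b] leads to that of [a ^+ 2], which is [x]
   because the road ends in a triangle. *)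
- move=> E; case/eqP: fix1; rewrite abX permM -E -permM -expg2.
  by apply/eqP; rewrite -in_triangle_translation ?groupX.
- by rewrite expgMn // permM => /perm_inj/eqP; apply/negP.
Qed.

Lemma road_end_conj x n j :
  porbit p ((a ^+ n.+1) ((p ^+ j) x)) = porbit p ((direction j ^+ n.+1) x).
Proof. by rewrite step_next porbit_perm. Qed.

(** By [same_face], ends in one face agree up to [p ^+ 3], which is trivial in a triangle. *)
Lemma road_ends_face_neq x n i j : road x n -> i < j < 3 ->
  porbit p ((direction i ^+ n.+1) x) != porbit p ((direction j ^+ n.+1) x).
Proof.
move=> rx ij; apply: contra (road_ends_neq rx ij); rewrite eq_porbit_mem.
set t := direction i ^+ _; set u := direction j ^+ _.
have [Tt Tu] : t \in T /\ u \in T by split; apply: groupX.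
have -> : t x = (u^-1 * t) (u x) by rewrite permM permK.
have tu : in_triangle (u x).
  by rewrite /u -in_triangle_step; case: (road_direction j rx).
by case/same_face => [|->|->]; rewrite ?(eqP tu) // groupM ?groupV.
Qed.

Lemma triangle_adj x n c : road x n -> c \in triangles G -> c != porbit p x ->
  curvature_adj (porbit p x) c.
Proof.
move=> rx tc cx.
have tx : in_triangle x by case: rx.
pose e j := porbit p ((direction j ^+ n.+1) x).
have te j : e j \in triangles G.
  by rewrite triangle_porbit -in_triangle_step; case: (road_direction j rx).
have ex j : porbit p x != e j.
  have := road_end (road_direction j rx).
  by rewrite -eq_porbit_mem road_end_conj porbit_perm eq_sym.
have adj j : curvature_adj (porbit p x) (e j).
  have := road_pseudo_road (road_direction j rx).
  by rewrite road_end_conj porbit_perm.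
have defS : [set porbit p x; e 0; e 1%N; e 2] = triangles G.
  apply/eqP; rewrite eqEcard; apply/andP; split.
    apply/subsetP=> d; rewrite !in_setU !in_set1 -!orbA.
    by case/or4P=> /eqP->; rewrite ?te ?triangle_porbit.
  rewrite card_triangles -!setUA !cardsU1 !inE cards1 !negb_or.
  by rewrite !ex !road_ends_face_neq.
move: tc; rewrite -defS !in_setU !in_set1 (negPf cx) /=.
by case/orP=> [/orP[]|] /eqP->.
Qed.

End Tight.
End Trihex.

Theorem proposition8p4 (G : cmap) (trihexG : trihex G) (tightG : tight G) :
  complete_graph (triangles G) (@curvature_adj G) 4.
Proof.
split; first exact: card_triangles.
move=> c d tc td; split.
  case=> s /(pseudo_road_step trihexG)[x [-> -> /(road_end trihexG)]].
  by move=> xn E; rewrite E porbit_id in xn.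
move=> cd.
have : c \in faces G by move: tc; rewrite inE => /andP[].
case/imsetP=> x _ cE; move: tc; rewrite cE triangle_porbit // => /road_from[n rx].
by apply: triangle_adj rx td _ => //; apply/eqP=> E; case: cd; rewrite cE E.
Qed.
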